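(* Let $f,g,p,q_0,q_K,\mathcal Q,J_{\text{limit}},\alpha_1,\alpha_2$ be as in the context. Let $u(t)$, $t\ge 0$, be a control input with corresponding trajectory $x(t)$ of $\dot x=f(x)+g(x)u$, and let $J_{\max}$ and $\bar J$ be the quantities associated with this trajectory defined in the context. Define the lower-bound control barrier function $$h_{\bar J}(x,t;q_0,q_K)=\min_{q\in\mathcal Q}\bigl(J_{\text{limit}}-\bar J(t;q_0,q_K)\bigr),$$ and the corresponding higher-order control barrier functions $$\bar\Phi_1(x,t;q_0,q_K):=-\max_{s\in[0,1]}p\bigl(q(s),x(t)\bigr)+\alpha_1 h_{\bar J}(x,t;q_0,q_K),$$ $$\bar\Phi_2(x,t;q_0,q_K):=\dot{\bar\Phi}_1(x,t;q_0,q_K)+\alpha_2\bar\Phi_1(x,t;q_0,q_K),$$ where the dot denotes the time derivative along the trajectory. If the control $u(t)$ satisfies the constraint $$\bar\Phi_2(x,t;q_0,q_K)\ge 0$$ along the trajectory (for all $t\ge 0$), then $J_{\max}(t)\le J_{\text{limit}}$ for all $t\ge 0$.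
   Context: Consider the nonlinear control-affine system $\dot x=f(x)+g(x)u$ with state $x\in\mathbb{R}^n$, control input $u\in\mathbb{R}^m$ and smooth vector fields $f,g$. For each state $x$, let $q\mapsto p(q,x)$ be a scalar field $\mathbb{R}^d\to\mathbb{R}_+$ representing the effect at the point $q$ of an agent in state $x$. Let $q_0,q_K\in\mathbb{R}^d$, and let $\mathcal Q=\{q(s):s\in[0,1]\}$ be the line segment parametrized by $q(s)=(1-s)q_0+s\,q_K$. Standing assumption: $\nabla_x p(q,x)^{\mathrm T}g(x)\ne 0$ for the points $q\in\mathcal Q$ and states $x$ considered. Let $J_{\text{limit}}$ be the maximum permissible value of the accumulated cost $J$ defined below, and let $\alpha_1,\alpha_2$ be positive constants (gains of linear class-$\mathcal K$ functions). For a trajectory $x(t)$, $t\ge0$, the accumulated cost at $q\in\mathbb{R}^d$ is $$J(q,t)=\int_0^t p\bigl(q,x(\tau)\bigr)\,d\tau,$$ and its maximum over the segment is $$J_{\max}(t)=J\bigl(q(s^*(t)),t\bigr),\qquad s^*(t)=\arg\max_{s\in[0,1]}J(q(s),t).$$ The function $\bar J(t;q_0,q_K)$ is defined by $$\bar J(0;q_0,q_K)=J_{\max}(0),\qquad \dot{\bar J}(t;q_0,q_K)=\max_{s\in[0,1]}p\bigl(q(s),x(t)\bigr).$$ *)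

(* Defs.v *)
From HB Require Import structures.
From mathcomp Require Import all_boot all_order all_algebra.
From mathcomp Require Import all_classical all_reals all_analysis.

Set Implicit Arguments.
Unset Strict Implicit.
Unset Printing Implicit Defensive.

Import Order.TTheory GRing.Theory Num.Theory.
Import numFieldNormedType.Exports.

Local Open Scope classical_set_scope.
Local Open Scope ring_scope.

(* In finite dimension, F is C^(k+1) iff it is differentiable and all its
   directional derivatives are C^k. *)
Fixpoint is_Ck (R : realType) (n : nat) (W : normedModType R) (k : nat)
    (F : 'cV[R]_n -> W) : Prop :=
  match k with
  | 0 => continuous F
  | k'.+1 => (forall x, differentiable F x) /\
             (forall v, is_Ck k' (fun x => 'D_v F x))
  end.

Definition smooth (R : realType) (n : nat) (W : normedModType R)
    (F : 'cV[R]_n -> W) : Prop := forall k, is_Ck k F.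

Definition gradient (R : realType) (n : nat) (F : 'cV[R]_n -> R)
    (x : 'cV[R]_n) : 'cV[R]_n :=
  \col_i 'D_(delta_mx i 0) F x.

Definition C1_in_state (R : realType) (d n : nat)
    (p : 'cV[R]_d -> 'cV[R]_n -> R) : Prop :=
  [/\ continuous (fun y : 'cV[R]_d * 'cV[R]_n => p y.1 y.2),
      forall q x, differentiable (p q) x &
      continuous (fun y : 'cV[R]_d * 'cV[R]_n => gradient (p y.1) y.2)].

(* Time derivative of a function of time t >= 0: the increments h are
   restricted to t + h >= 0, so this is the ordinary two-sided derivative when
   t > 0, and the right derivative when t = 0.  Values at negative times play
   no role. *)
Definition has_time_derivative (R : realType) (W : normedModType R)
    (y : R -> W) (t : R) (dy : W) : Prop :=
  h^-1 *: (y (t + h) - y t) @[h --> within [set h | 0 <= t + h] 0^'] --> dy.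

(* Right time derivative.  It equals the time derivative above whenever the
   latter exists. A maximum over s of C^1 functions need not be two-sided
   differentiable where the maximizer switches, but it does have a right
   derivative there (Danskin), so this is the meaning of the dot over
   expressions containing max_s. *)
Definition right_time_derivative (R : realType) (y : R -> R) (t : R) : R :=
  lim (h^-1 * (y (t + h) - y t) @[h --> 0^'+]).

Section SegmentCost.
Context {R : realType} {d n : nat}.
Variables (p : 'cV[R]_d -> 'cV[R]_n -> R) (q0 qK : 'cV[R]_d).

Definition seg_point (s : R) : 'cV[R]_d := (1 - s) *: q0 + s *: qK.

Definition seg : set 'cV[R]_d := [set seg_point s | s in `[0, 1]].

Definition J_cost (x : R -> 'cV[R]_n) (q : 'cV[R]_d) (t : R) : R :=
  \int[lebesgue_measure]_(tau in `[0, t]) p q (x tau).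

Definition is_argmax01 (F : R -> R) (s : R) : Prop :=
  s \in `[0, 1] /\ (forall s', s' \in `[0, 1] -> F s' <= F s).

(* J_max, for a selection sstar of the argmax *)
Definition Jmax (x : R -> 'cV[R]_n) (sstar : R -> R) (t : R) : R :=
  J_cost x (seg_point (sstar t)) t.

(* max_(s in [0,1]) p (q s) x; the supremum is attained since p is continuous *)
Definition max_cost (x : 'cV[R]_n) : R :=
  sup [set p (seg_point s) x | s in `[0, 1]].

(* The minimum over the segment of a quantity that does not depend on q *)
Definition hbar (Jlimit : R) (Jbar : R -> R) (t : R) : R :=
  inf [set Jlimit - Jbar t | q in seg].

Definition Phi1bar (Jlimit alpha1 : R) (Jbar : R -> R) (x : R -> 'cV[R]_n)
    (t : R) : R :=
  - max_cost (x t) + alpha1 * hbar Jlimit Jbar t.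

Definition Phi2bar (Jlimit alpha1 alpha2 : R) (Jbar : R -> R)
    (x : R -> 'cV[R]_n) (t : R) : R :=
  right_time_derivative (Phi1bar Jlimit alpha1 Jbar x) t
  + alpha2 * Phi1bar Jlimit alpha1 Jbar x t.

End SegmentCost.

(* Main.v *)
Require Import Defs.
From HB Require Import structures.
From mathcomp Require Import all_boot all_order all_algebra.
From mathcomp Require Import all_classical all_reals all_analysis.
From mathcomp Require Import lra.
Import Order.TTheory GRing.Theory Num.Theory.
Import numFieldNormedType.Exports.
Local Open Scope classical_set_scope.
Local Open Scope ring_scope.

(** The accumulated cost J at a fixed point of the segment grows at the rate
    p (q, x), which is at most the rate of Jbar; both start at 0, so
    Jmax <= Jbar ([Jmax_le_Jbar]), and it suffices to bound Jbar by Jlimit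
    ([Jbar_le_Jlimit]).

    Write h = Jlimit - Jbar, so that h' = - M with M >= 0 the maximal cost rate,
    and Phi1 = - M + alpha1 * h.  Suppose that h T < 0.  As h is nonincreasing,
    Phi1 t <= alpha1 * h T < 0 for every t >= T.  The constraint
    Phi1' + alpha2 * Phi1 >= 0 then gives
    Phi1' >= - alpha1 * alpha2 * h T > 0 from T on, so Phi1 grows at least
    linearly and must become positive, a contradiction.  The argument uses the
    constraint on the whole half-line in place of an initial condition such as
    h 0 >= 0 or Phi1 0 >= 0.

    The only analytic difficulty is that Phi1 contains a maximum over s, so its
    derivative is one-sided.  A lower bound on a right derivative integrates to
    a lower bound on increments as soon as the function does not jump down
    when its argument is approached from the left ([ndecr_of_right_ndecr]).
    This is an upper semicontinuity property of Phi1, and it holds because M, a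
    supremum of continuous functions, is lower semicontinuous
    ([max_cost_lsc]). *)

(** * Monotonicity from one-sided information *)

(** The supremum of the t in [a, b] with z a <= z t belongs to that set, by the
    condition on the left, and cannot be smaller than b, by the condition on the
    right. *)
Lemma ndecr_of_right_ndecr (R : realType) (z : R -> R) (a b : R) :
    (forall t e, a < t -> 0 < e -> \forall s \near t^'-, z s <= z t + e) ->
    (forall t, a <= t -> \forall s \near t^'+, z t <= z s) ->
  a <= b -> z a <= z b.
Proof.
move=> zleft zright ab.
pose S := [set t | a <= t <= b /\ z a <= z t].
have Sa : S a by split; rewrite ?lexx.
have Sub : has_ubound S by exists b => t [/andP[]].
have supS : has_sup S by split => //; exists a.
have aS : a <= sup S by exact: ub_le_sup.
have Sb : sup S <= b by apply: ge_sup; [exists a|move=> t [/andP[]]].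
have zS : z a <= z (sup S).
  move: aS; rewrite le_eqVlt => /predU1P[<-//|aS].
  apply/ler_addgt0Pr => e e0.
  have := zleft _ _ aS e0; rewrite -nbhs_nearE /at_left /within/= => -[r /= r0 ner].
  have [s [/andP[as_ sb] zs] sS] := sup_adherent r0 supS.
  have sleS : s <= sup S by apply: ub_le_sup => //; split => //; rewrite as_.
  move: sleS; rewrite le_eqVlt => /predU1P[<-|sltS].
    by rewrite (le_trans zs)// lerDl ltW.
  apply: (le_trans zs); apply: ner => //=.
  by rewrite ger0_norm ?subr_ge0 ?ltW// ltrBlDr addrC -ltrBlDr.
move: Sb; rewrite le_eqVlt => /predU1P[<-//|Sltb].
have [s [Ss sb zs]] : exists s, [/\ sup S < s, s <= b & z (sup S) <= z s].
  near ((sup S)^'+) => s; exists s; split; near: s.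
  - exact: nbhs_right_gt.
  - exact: nbhs_right_le.
  - exact: zright.
have : s <= sup S.
  by apply: ub_le_sup => //; split; rewrite ?(le_trans zS)// sb (le_trans aS)// ltW.
by rewrite leNgt Ss.
Unshelve. all: by end_near. Qed.

(** * Time derivatives on the half-line *)

Lemma near_at_right_shift (R : realType) (t : R) (P : set R) :
  (\forall h \near 0^'+, P (t + h)) -> \forall s \near t^'+, P s.
Proof.
move=> [e /= e0 eP]; exists e => //= s ste ts.
have := eP (s - t); rewrite /= sub0r normrN distrC subr_gt0 (addrC t (s - t)) subrK.
by apply.
Qed.

Lemma time_derivative_right (R : realType) (W : normedModType R)
    (y : R -> W) (t : R) (dy : W) : 0 <= t -> has_time_derivative y t dy ->
  h^-1 *: (y (t + h) - y t) @[h --> 0^'+] --> dy.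
Proof.
move=> t0; apply: cvg_trans; apply: cvg_app.
move=> A [e /= e0 eA]; exists e => //= h he h0.
apply: eA => //=; first by rewrite gt_eqF.
by rewrite addr_ge0// ltW.
Qed.

Lemma time_derivative_cvg_right (R : realType) (W : normedModType R)
    (y : R -> W) (t : R) (dy : W) : 0 <= t -> has_time_derivative y t dy ->
  y s @[s --> t^'+] --> y t.
Proof.
move=> t0 /(time_derivative_right _ _ _ _ _ t0) dyt.
suff ytA : y (t + h) @[h --> 0^'+] --> y t.
  by move=> A /ytA; exact: near_at_right_shift.
rewrite -[X in _ --> X]add0r -(scale0r dy).
have : h *: (h^-1 *: (y (t + h) - y t)) + y t @[h --> 0^'+] --> 0 *: dy + y t.
  apply: cvgD; last exact: cvg_cst.
  by apply: cvgZ => //; exact: cvg_at_right_filter cvg_id.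
apply: cvg_trans; apply: near_eq_cvg; near=> h.
have h0 : h != 0 by rewrite gt_eqF//; near: h; exact: nbhs_right_gt.
by rewrite /= scalerA mulfV// scale1r subrK addrC.
Unshelve. all: by end_near. Qed.

Lemma time_derivative_is_derive (R : realType) (W : normedModType R)
    (y : R -> W) (t : R) (dy : W) : 0 < t -> has_time_derivative y t dy ->
  is_derive t 1 y dy.
Proof.
move=> t0 dyt.
have dy' : h^-1 *: ((y \o shift t) (h *: 1) - y t) @[h --> 0^'] --> dy.
  apply: cvg_trans dyt.
  under eq_fun do rewrite /= (addrC _ t) scaler1.
  apply: cvg_app; move=> A [e /= e0 eA].
  exists (Num.min e t) => /=; first by rewrite lt_min e0.
  move=> h /=; rewrite lt_min => /andP[he ht] h0.
  apply: eA => //=; move: ht; rewrite sub0r normrN ltr_norml => /andP[ht _].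
  by rewrite ltW// -ltrBlDl sub0r.
by apply: DeriveDef; [apply/cvg_ex; exists dy|exact: cvg_lim].
Qed.

Lemma time_derivative_continuous (R : realType) (W : normedModType R)
    (y dy : R -> W) :
    (forall t, 0 <= t -> has_time_derivative y t (dy t)) ->
  forall t, 0 < t -> {for t, continuous y}.
Proof.
move=> dyt t t0; apply: differentiable_continuous; apply/derivable1_diffP.
by have [] := time_derivative_is_derive _ _ _ _ _ t0 (dyt _ (ltW t0)).
Qed.

Lemma time_derivative_within_continuous (R : realType) (W : normedModType R)
    (y dy : R -> W) :
    (forall t, 0 <= t -> has_time_derivative y t (dy t)) ->
  forall T, 0 < T -> {within `[0, T], continuous y}.
Proof.
move=> dyt T T0; apply/continuous_within_itvP => //; split.
- by move=> t; rewrite in_itv/= => /andP[t0 _]; exact: (time_derivative_continuous _ _ _ _ dyt).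
- exact: time_derivative_cvg_right _ _ _ _ _ (lexx _) (dyt _ (lexx _)).
- exact: cvg_at_left_filter (time_derivative_continuous _ _ _ _ dyt _ T0).
Qed.

Lemma time_derivative_ge0_ndecr (R : realType) (y dy : R -> R) :
    (forall t, 0 <= t -> has_time_derivative y t (dy t)) ->
    (forall t, 0 <= t -> 0 <= dy t) ->
  forall s t, 0 <= s -> s <= t -> y s <= y t.
Proof.
move=> ydy dy0 s t s0; rewrite le_eqVlt => /predU1P[->//|st].
have t0 : 0 < t by exact: le_lt_trans st.
apply: (@ger0_derive1_ndecr _ y 0 t) => //; last exact: ltW.
- move=> r; rewrite in_itv/= => /andP[r0 _].
  by have [] := time_derivative_is_derive _ _ _ _ _ r0 (ydy _ (ltW r0)).
- move=> r; rewrite in_itv/= => /andP[r0 _].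
  have := time_derivative_is_derive _ _ _ _ _ r0 (ydy _ (ltW r0)) => ?.
  by rewrite derive1E derive_val dy0// ltW.
- exact: (time_derivative_within_continuous _ _ _ _ ydy _ t0).
Qed.

(** The rate dy is not assumed integrable: the integral of f is differentiated
    instead, and the difference of y and that integral is nondecreasing. *)
Lemma Rintegral_le_increment (R : realType) (f y dy : R -> R) (T : R) :
    0 < T -> {within `[0, T], continuous f} ->
    {within `[0, T], continuous y} ->
    (forall t, 0 < t < T -> is_derive t 1 y (dy t)) ->
    (forall t, 0 < t < T -> f t <= dy t) ->
  \int[lebesgue_measure]_(t in `[0, T]) f t <= y T - y 0.
Proof.
move=> T0 fcont ycont ydy fdy.
have fint : lebesgue_measure.-integrable `[0, T] (EFin \o f).
  by apply: continuous_compact_integrable => //; exact: segment_compact.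
pose F t := \int[lebesgue_measure]_(s in `[0, t]) f s.
have FTC t : 0 < t < T -> derivable F t 1 /\ F^`()%classic t = f t.
  move=> /andP[t0 tT].
  apply: (continuous_FTC1 tT fint) => //=.
  have /(continuous_within_itvP _ T0)[+ _ _] := fcont.
  by apply; rewrite in_itv/= t0.
have yF t : 0 < t < T -> is_derive t 1 (y - F) (dy t - f t).
  move=> tT; have [dF F'] := FTC t tT.
  apply: is_deriveB; first exact: ydy.
  by apply: DeriveDef => //; rewrite -F' derive1E.
have /(_ 0 T (lexx _) (ltW T0) (lexx _)) : forall s t, 0 <= s -> s <= t -> t <= T -> (y - F) s <= (y - F) t.
  apply: ger0_derive1_ndecr.
  - by move=> t; rewrite in_itv/= => /yF[].
  - move=> t; rewrite in_itv/= => tT; have := yF _ tT => ?.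
    by rewrite derive1E derive_val subr_ge0 fdy.
  - move=> t; apply: cvgB; first exact: ycont.
    exact: (parameterized_integral_continuous (ltW T0) fint).
rewrite !fctE /F set_itv1 Rintegral_set1 subr0.
by rewrite lerBrDr addrC -lerBrDr.
Qed.

(** A divergent filter on R has limit value 0, so a positive value of the right
    derivative certifies by itself that the difference quotients converge; this
    is why c >= 0 is assumed. *)
Lemma right_time_derivative_gt (R : realType) (y : R -> R) (t c : R) :
  0 <= c < right_time_derivative y t ->
  \forall s \near t^'+, y t + c * (s - t) <= y s.
Proof.
rewrite /right_time_derivative => /andP[c0 cy].
set S := (X in lim X) in cy.
have yS : S --> lim S.
  apply: contrapT => /dvgP S0; move: cy; rewrite S0.
  by move=> /(le_lt_trans c0); rewrite ltxx.
have slope : \forall h \near 0^'+, c < h^-1 * (y (t + h) - y t).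
  exact: (cvgr_gt _ yS).
apply: near_at_right_shift; near=> h.
have h0 : 0 < h by near: h; exact: nbhs_right_gt.
have : c < h^-1 * (y (t + h) - y t) by near: h.
rewrite mulrC ltr_pdivlMr// ltrBrDr addrC => /ltW.
by rewrite (addrC t h) addrK.
Unshelve. all: by end_near. Qed.

(** * The maximal cost rate over the segment *)

Section SegmentMax.
Context {R : realType} {d n : nat}.
Variables (p : 'cV[R]_d -> 'cV[R]_n -> R) (q0 qK : 'cV[R]_d).
Hypothesis pcont : continuous (fun z : 'cV[R]_d * 'cV[R]_n => p z.1 z.2).

Lemma continuous_seg_point : continuous (seg_point q0 qK).
Proof.
move=> s; apply: cvgD; apply: cvgZr_tmp.
  by apply: cvgB; [exact: cvg_cst|exact: cvg_id].
exact: cvg_id.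
Qed.

Lemma continuous_cost_state q : continuous (p q).
Proof.
move=> y; apply: (@continuous2_cvg _ _ _ _ (nbhs y) _ (fun=> q) id p q y).
- exact: (pcont (q, y)).
- exact: cvg_cst.
- exact: cvg_id.
Qed.

Lemma has_sup_segment_cost y :
  has_sup [set p (seg_point q0 qK s) y | s in `[0, 1]].
Proof.
split; first by exists (p (seg_point q0 qK 0) y), 0 => //=; rewrite in_itv/= lexx ler01.
have [] := @EVT_max R (fun s => p (seg_point q0 qK s) y) 0 1 ler01.
  apply: continuous_subspaceT => s.
  apply: (@continuous2_cvg _ _ _ _ (nbhs s) _ (seg_point q0 qK) (fun=> y) p).
  - exact: (pcont (seg_point q0 qK s, y)).
  - exact: continuous_seg_point.
  - exact: cvg_cst.
move=> s _ smax; exists (p (seg_point q0 qK s) y) => _ [s' s'01 <-].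
exact: smax.
Qed.

Lemma le_max_cost s y : s \in `[0, 1] ->
  p (seg_point q0 qK s) y <= max_cost p q0 qK y.
Proof.
move=> s01; apply: ub_le_sup; last by exists s.
by have [] := has_sup_segment_cost y.
Qed.

(** A point of the segment that is almost optimal at y stays almost as costly at
    nearby states, and the maximum there is at least as large. *)
Lemma max_cost_lsc y e : 0 < e ->
  \forall z \near y, max_cost p q0 qK y - e < max_cost p q0 qK z.
Proof.
move=> e0; have [_ [s s01 <-] ps] := sup_adherent e0 (has_sup_segment_cost y).
near=> z; apply: (@lt_le_trans _ _ (p (seg_point q0 qK s) z)); last first.
  exact: le_max_cost.
by near: z; exact: (cvgr_gt _ (continuous_cost_state _ y)) ps.
Unshelve. all: by end_near. Qed.

Lemma max_cost_ge0 y : (forall q z, 0 <= p q z) -> 0 <= max_cost p q0 qK y.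
Proof.
move=> p0; apply: le_trans (p0 _ _) (le_max_cost 0 y _).
by rewrite in_itv/= lexx ler01.
Qed.

End SegmentMax.

(** The set under the infimum is a singleton because the segment is
    nonempty. *)
Lemma hbarE (R : realType) (d : nat) (q0 qK : 'cV[R]_d) (Jlimit : R)
  (Jbar : R -> R) (t : R) : hbar q0 qK Jlimit Jbar t = Jlimit - Jbar t.
Proof.
rewrite /hbar (_ : [set _ | _ in _] = [set Jlimit - Jbar t]) ?inf1//.
apply/seteqP; split => [_ [q _ <-]//|_ ->].
exists (seg_point q0 qK 0) => //; exists 0 => //=.
by rewrite in_itv/= lexx ler01.
Qed.

(** * The barrier argument *)

(** The maximum over the segment of an integral is at most the integral of the
    maximum.  The right-hand side is handled only through its time derivative,
    so no measurability of the maximal cost rate has to be discussed. *)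
Lemma Jmax_le_Jbar (R : realType) (d n : nat)
    (p : 'cV[R]_d -> 'cV[R]_n -> R) (q0 qK : 'cV[R]_d)
    (x dx : R -> 'cV[R]_n) (sstar Jbar : R -> R) :
    continuous (fun z : 'cV[R]_d * 'cV[R]_n => p z.1 z.2) ->
    (forall t, 0 <= t -> has_time_derivative x t (dx t)) ->
    (forall t, 0 <= t -> sstar t \in `[0, 1]) ->
    Jbar 0 = Jmax p q0 qK x sstar 0 ->
    (forall t, 0 <= t ->
       has_time_derivative Jbar t (max_cost p q0 qK (x t))) ->
  forall t, 0 <= t -> Jmax p q0 qK x sstar t <= Jbar t.
Proof.
move=> pcont hx s01 Jbar0 hJbar t.
rewrite le_eqVlt => /predU1P[<-|t0]; first by rewrite Jbar0.
have Jbar00 : Jbar 0 = 0 by rewrite Jbar0 /Jmax /J_cost set_itv1 Rintegral_set1.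
rewrite -[leRHS]subr0 -Jbar00 /Jmax.
apply: (@Rintegral_le_increment _ _ Jbar (fun s => max_cost p q0 qK (x s))).
- exact: t0.
- move=> s; apply: continuous_comp.
    exact: (time_derivative_within_continuous _ _ _ _ hx _ t0).
  exact: continuous_cost_state.
- exact: (time_derivative_within_continuous _ _ _ _ hJbar _ t0).
- move=> s /andP[s0 _]; apply: time_derivative_is_derive => //.
  by apply: hJbar; exact: ltW.
- by move=> s _; apply: le_max_cost => //; apply: s01; exact: ltW.
Qed.

(** Upper semicontinuity only: - max_cost is an infimum of continuous
    functions. *)
Lemma Phi1bar_usc (R : realType) (d n : nat)
    (p : 'cV[R]_d -> 'cV[R]_n -> R) (q0 qK : 'cV[R]_d) (Jlimit alpha1 : R)
    (x : R -> 'cV[R]_n) (Jbar : R -> R) (t e : R) :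
    continuous (fun z : 'cV[R]_d * 'cV[R]_n => p z.1 z.2) ->
    {for t, continuous x} -> {for t, continuous Jbar} -> 0 < e ->
  \forall s \near t, Phi1bar p q0 qK Jlimit alpha1 Jbar x s
                     <= Phi1bar p q0 qK Jlimit alpha1 Jbar x t + e.
Proof.
move=> pcont xt Jt e0; have e20 : 0 < e / 2 by rewrite divr_gt0.
have Mt : \forall s \near t,
    max_cost p q0 qK (x t) - e / 2 < max_cost p q0 qK (x s).
  exact: (xt _ (max_cost_lsc _ q0 qK pcont _ _ e20)).
have Jbt : \forall s \near t,
    alpha1 * Jbar t - e / 2 < alpha1 * Jbar s.
  apply: (@cvgr_gt R R (nbhs t) _ (fun s => alpha1 * Jbar s)
    (alpha1 * Jbar t)); first exact: cvgMr.
  by rewrite ltrBlDr ltrDl.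
near=> s; rewrite /Phi1bar !hbarE.
have Ms : max_cost p q0 qK (x t) - e / 2 < max_cost p q0 qK (x s) by near: s.
have Js : alpha1 * Jbar t - e / 2 < alpha1 * Jbar s by near: s.
lra.
Unshelve. all: by end_near. Qed.

(** This is where the constraint acts.  Once the bound is violated at T it stays
    violated, because Jbar is nondecreasing, and it keeps Phi1bar below
    the negative constant - k.  The constraint turns this into a slope of at
    least alpha2 * k for Phi1bar, so Phi1bar would exceed - k after a finite
    time. *)
Lemma Jbar_le_Jlimit (R : realType) (d n : nat)
    (p : 'cV[R]_d -> 'cV[R]_n -> R) (q0 qK : 'cV[R]_d)
    (Jlimit alpha1 alpha2 : R) (x dx : R -> 'cV[R]_n) (Jbar : R -> R) :
    (forall q y, 0 <= p q y) ->
    continuous (fun z : 'cV[R]_d * 'cV[R]_n => p z.1 z.2) ->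
    0 < alpha1 -> 0 < alpha2 ->
    (forall t, 0 <= t -> has_time_derivative x t (dx t)) ->
    (forall t, 0 <= t ->
       has_time_derivative Jbar t (max_cost p q0 qK (x t))) ->
    (forall t, 0 <= t ->
       0 <= Phi2bar p q0 qK Jlimit alpha1 alpha2 Jbar x t) ->
  forall t, 0 <= t -> Jbar t <= Jlimit.
Proof.
move=> p0 pcont alpha10 alpha20 hx hJbar hPhi2 T T0.
rewrite leNgt; apply/negP => JT.
pose Phi := Phi1bar p q0 qK Jlimit alpha1 Jbar x.
have M0 t : 0 <= max_cost p q0 qK (x t) by exact: max_cost_ge0.
pose k := alpha1 * (Jbar T - Jlimit).
have k0 : 0 < k by rewrite mulr_gt0// subr_gt0.
have Phik t : T <= t -> Phi t <= - k.
  move=> Tt; rewrite /Phi /Phi1bar hbarE /k -mulrN opprB -[leRHS]add0r.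
  rewrite lerD ?oppr_le0// ler_pM2l// lerD2l lerN2.
  exact: (time_derivative_ge0_ndecr _ _ _ hJbar).
(* Half of the slope alpha2 * k: a limit of difference quotients bounds the
   quotients themselves only up to a strict loss. *)
pose c := alpha2 * k / 2.
have c0 : 0 < c by rewrite divr_gt0// mulr_gt0.
have Phi_slope t : T <= t -> \forall s \near t^'+, Phi t + c * (s - t) <= Phi s.
  move=> Tt; apply: right_time_derivative_gt; rewrite (ltW c0)/=.
  have := hPhi2 t (le_trans T0 Tt); rewrite /Phi2bar -/Phi.
  have : alpha2 * Phi t <= alpha2 * (- k) by rewrite ler_pM2l// Phik.
  by rewrite mulrN; have := c0; rewrite /c; lra.
have Phi_grows t : T <= t -> Phi T + c * (t - T) <= Phi t.
  move=> Tt.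
  suff : Phi T - c * (T - T) <= Phi t - c * (t - T).
    by rewrite subrr mulr0 subr0 lerBrDr.
  apply: (@ndecr_of_right_ndecr _ (fun t => Phi t - c * (t - T))) => //.
  - move=> r e Tr e0; have r0 : 0 < r by exact: le_lt_trans Tr.
    have e20 : 0 < e / 2 by rewrite divr_gt0.
    have Phir : \forall s \near r, Phi s <= Phi r + e / 2.
      apply: Phi1bar_usc => //.
        exact: (time_derivative_continuous _ _ _ _ hx _ r0).
      exact: (time_derivative_continuous _ _ _ _ hJbar _ r0).
    have cr : \forall s \near r, c * r - e / 2 < c * s.
      apply: (@cvgr_gt R R (nbhs r) _ (fun s => c * s) (c * r)).
        by apply: cvgMr; exact: cvg_id.
      by rewrite ltrBlDr ltrDl.
    near=> s.
    have Phis : Phi s <= Phi r + e / 2.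
      by near: s; apply: cvg_at_left_filter Phir; exact: cvg_id.
    have cs : c * r - e / 2 < c * s.
      by near: s; apply: cvg_at_left_filter cr; exact: cvg_id.
    lra.
  - by move=> r Tr; apply: filterS (Phi_slope r Tr) => s; lra.
(* The time at which the line of slope c from (T, Phi T) reaches 0. *)
pose t := T - Phi T / c.
have Tt : T <= t.
  rewrite lerDl oppr_ge0 pmulr_lle0 ?invr_gt0//.
  by rewrite (le_trans (Phik _ (lexx _)))// oppr_le0 ltW.
have := le_trans (Phi_grows _ Tt) (Phik _ Tt).
rewrite /t (addrAC T) subrr add0r mulrN mulrCA divff ?gt_eqF// mulr1 subrr.
by rewrite oppr_ge0 leNgt k0.
Unshelve. all: by end_near. Qed.

Theorem proposition1 (R : realType) (n m d : nat)
  (f : 'cV[R]_n -> 'cV[R]_n) (g : 'cV[R]_n -> 'M[R]_(n, m))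
  (p : 'cV[R]_d -> 'cV[R]_n -> R) (q0 qK : 'cV[R]_d)
  (Jlimit alpha1 alpha2 : R)
  (u : R -> 'cV[R]_m) (x : R -> 'cV[R]_n) (sstar : R -> R) (Jbar : R -> R)
  (hf : smooth f) (hg : smooth g)
  (hp0 : forall q y, 0 <= p q y) (hp : C1_in_state p)
  (halpha1 : 0 < alpha1) (halpha2 : 0 < alpha2)
  (hx : forall t, 0 <= t ->
     has_time_derivative x t (f (x t) + g (x t) *m u t))
  (hpg : forall q t, q \in seg q0 qK -> 0 <= t ->
     (gradient (p q) (x t))^T *m g (x t) != 0)
  (hsstar : forall t, 0 <= t ->
     is_argmax01 (fun s => J_cost p x (seg_point q0 qK s) t)
       (sstar t))
  (hJbar0 : Jbar 0 = Jmax p q0 qK x sstar 0)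
  (hJbar : forall t, 0 <= t ->
     has_time_derivative Jbar t (max_cost p q0 qK (x t)))
  (hPhi2 : forall t, 0 <= t ->
     0 <= Phi2bar p q0 qK Jlimit alpha1 alpha2 Jbar x t) :
  forall t, 0 <= t -> Jmax p q0 qK x sstar t <= Jlimit.
Proof.
have [pcont _ _] := hp.
move=> t t0; apply: (@le_trans _ _ (Jbar t)).
  apply: (Jmax_le_Jbar _ _ _ _ _ _ _ _ _ _ pcont hx) => // s s0.
  by have [] := hsstar s s0.
exact: (Jbar_le_Jlimit _ _ _ _ _ _ _ _ _ _ _ _ hp0 pcont halpha1 halpha2 hx
  hJbar hPhi2).
Qed.
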